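(* Let $K$ be a field and let $I$ be a squarefree Borel ideal in a polynomial ring over $K$ in finitely many variables $x_1,x_2,\ldots$, with Borel generators $u_1,\ldots,u_m$, all of the same degree, and suppose that $I$ is not a principal ideal (i.e. $I$ is not generated by one element). For $i=1,\ldots,m$ let $B_{i1}\sqcup B_{i2}\sqcup\cdots\sqcup B_{ik_i}$ be the block decomposition of $u_i$, and set $n=\max\{\max(u_i): 1\le i\le m\}$. Then the analytic spread of $I$ is $$\ell(I)=\begin{cases} n & \text{if } 1\notin\bigcap_{i=1}^m B_{i1},\\ n-\left|\bigcap_{i=1}^m B_{i1}\right| & \text{otherwise.}\end{cases}$$
   Context: $\operatorname{supp}(u)=\{i:x_i\mid u\}$ and $\max(u)=\max(\operatorname{supp}(u))$. A squarefree monomial ideal $I$ (one generated by squarefree monomials) is a squarefree Borel ideal (also called $1$-Borel) if for every squarefree monomial $u\in I$, every $j\in\operatorname{supp}(u)$ and every $i<j$ one has $x_i(u/x_j)\in I$, provided $x_i(u/x_j)$ is squarefree. The squarefree Borel ideal with Borel generators $u_1,\ldots,u_m$ is the smallest squarefree Borel ideal containing $u_1,\ldots,u_m$. It is equigenerated (generated in a single degree) here because all $u_i$ have the same degree. A block of a squarefree monomial $u$ is a subset of $\operatorname{supp}(u)$ consisting of consecutive integers; a block is maximal if it is not properly contained in another block of $u$. The block decomposition of $u$ is the unique decomposition $\operatorname{supp}(u)=B_1\sqcup\cdots\sqcup B_r$ into maximal blocks, ordered so that $\max(B_i)<\min(B_{i+1})-1$ for all $i$; thus $B_{i1}$ is the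 maximal block of $u_i$ containing $\min(\operatorname{supp}(u_i))$. The analytic spread $\ell(I)$ is the Krull dimension of the fiber ring $\bigoplus_{r\ge0}I^r/\mathfrak m I^r$, where $\mathfrak m$ is the graded maximal ideal. *)

(* Defs.v *)
From HB Require Import structures.
From mathcomp Require Import all_boot all_order all_algebra.
From mathcomp Require Import ring_quotient.
From mathcomp Require Import boolp.
From mathcomp Require Import mpoly.

Set Implicit Arguments.
Unset Strict Implicit.
Unset Printing Implicit Defensive.

Import GRing.Theory.
Local Open Scope ring_scope.

(* Subsets of a ring are collective predicates {pred R}; since decidability   *)
(* is classical here, these are arbitrary subsets.                            *)

Section Ideals.
Variable R : comNzRingType.
Implicit Types (S I J : {pred R}).

(* mathcomp's idealr_closed only describes proper ideals. *)
Definition is_ideal I : Prop :=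
  0 \in I /\ forall a, {in I &, forall u v, a * u + v \in I}.

Definition gen_ideal S : {pred R} := [pred x : R |
  `[< exists2 s : seq (R * R),
        all [pred c | c.2 \in S] s & x = \sum_(c <- s) c.1 * c.2 >]].

Definition ideal_mul I J : {pred R} := gen_ideal [pred x : R |
  `[< exists a b, [/\ a \in I, b \in J & x = a * b] >]].

Fixpoint ideal_exp I (r : nat) : {pred R} :=
  if r is r'.+1 then ideal_mul I (ideal_exp I r') else predT.

Definition principal I : Prop := exists f : R, I =i gen_ideal (pred1 f).

Lemma gen_ideal_is_ideal S : is_ideal (gen_ideal S).
Proof.
split; first by apply/asboolP; exists [::] => //; rewrite big_nil.
move=> a u v /asboolP[s sS ->] /asboolP[t tS ->]; apply/asboolP.
exists ([seq (a * c.1, c.2) | c <- s] ++ t).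
  by rewrite all_cat tS andbT all_map.
rewrite big_cat big_map mulr_sumr /=; congr (_ + _).
by apply: eq_bigr => c _; rewrite mulrA.
Qed.

Lemma mem_gen_ideal S x : x \in S -> x \in gen_ideal S.
Proof.
by move=> xS; apply/asboolP; exists [:: (1, x)]; rewrite /= ?xS // big_seq1 mul1r.
Qed.

Lemma gen_ideal_min S I : is_ideal I -> {subset S <= I} ->
  {subset gen_ideal S <= I}.
Proof.
move=> [I0 IP] SI x /asboolP[s + ->].
elim: s => [|c s IHs] /=; first by rewrite big_nil.
by case/andP=> /SI cI /IHs sI; rewrite big_cons IP.
Qed.

Lemma ideal_exp_is_ideal I r : is_ideal (ideal_exp I r).
Proof. by case: r => [|r]; [split | apply: gen_ideal_is_ideal]. Qed.

Lemma is_idealMl I a u : is_ideal I -> u \in I -> a * u \in I.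
Proof. by move=> [I0 IP] uI; rewrite -[a * u]addr0 IP. Qed.

Lemma is_idealD I u v : is_ideal I -> u \in I -> v \in I -> u + v \in I.
Proof. by move=> [I0 IP] uI vI; rewrite -[u]mul1r IP. Qed.

Lemma is_ideal_sum I (T : Type) (r : seq T) (F : T -> R) :
  is_ideal I -> (forall i, F i \in I) -> \sum_(i <- r) F i \in I.
Proof.
move=> idI FI; elim: r => [|i r IHr]; first by rewrite big_nil; case: idI.
by rewrite big_cons is_idealD.
Qed.

Lemma ideal_mul_colon I J u (L : {pred R}) : is_ideal L ->
    (forall a b, a \in I -> b \in J -> u * (a * b) \in L) ->
  forall x, x \in ideal_mul I J -> u * x \in L.
Proof.
move=> [L0 LP] IJL x xIJ; suff: x \in [pred y | u * y \in L] by [].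
apply: gen_ideal_min xIJ; first split; first by rewrite inE mulr0.
  by move=> a y z; rewrite !inE => yL zL; rewrite mulrDr mulrCA LP.
by move=> y /asboolP[a [b [aI bJ ->]]]; rewrite inE IJL.
Qed.

Lemma mem_ideal_mul I J a b : a \in I -> b \in J -> a * b \in ideal_mul I J.
Proof. by move=> aI bJ; apply/mem_gen_ideal/asboolP; exists a, b. Qed.

Lemma ideal_expD I r s u v : u \in ideal_exp I r -> v \in ideal_exp I s ->
  u * v \in ideal_exp I (r + s).
Proof.
move=> + vI; elim: r u => [|r IHr] u uI.
  by rewrite add0n; apply: is_idealMl vI; apply: ideal_exp_is_ideal.
rewrite mulrC; move: u uI; apply: ideal_mul_colon; first exact: ideal_exp_is_ideal.
by move=> a b aI bI; rewrite mulrC -mulrA addSn mem_ideal_mul ?IHr.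
Qed.

End Ideals.

Section KrullDim.
Variable A : comNzRingType.

Definition is_prime (P : {pred A}) : Prop :=
  idealr_closed P /\ prime_idealr_closed P.

Definition prime_chain (d : nat) (P : 'I_d.+1 -> {pred A}) : Prop :=
  (forall i, is_prime (P i)) /\
  (forall i j : 'I_d.+1, (i < j)%N ->
     {subset P i <= P j} /\ ~ {subset P j <= P i}).

Definition has_krull_dim (d : nat) : Prop :=
  (exists P : 'I_d.+1 -> {pred A}, prime_chain P) /\
  (forall e (P : 'I_e.+1 -> {pred A}), prime_chain P -> (e <= d)%N).

End KrullDim.

(* The Rees algebra \bigoplus_r I^r, as the subring of R[t] of the p such     *)
(* that the coefficient of t^r in p lies in I^r.                              *)
Section Rees.
Variables (R : comNzRingType) (I : {pred R}).

Definition rees_pred : {pred {poly R}} :=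
  [pred p : {poly R} | `[< forall r, p`_r \in ideal_exp I r >]].

Lemma rees_closed : subring_closed rees_pred.
Proof.
have idI := ideal_exp_is_ideal I.
split=> [|p q /asboolP pI /asboolP qI|p q /asboolP pI /asboolP qI];
  apply/asboolP=> r.
- by rewrite coef1; case: r => [|r] //=; case: (idI r.+1).
- by rewrite coefB -mulN1r addrC; apply: (idI r).2.
- rewrite coefM; apply: is_ideal_sum => // i.
  by have := ideal_expD (pI i) (qI (r - i)%N); rewrite subnKC // -ltnS.
Qed.

HB.instance Definition _ :=
  GRing.isSubringClosed.Build {poly R} rees_pred rees_closed.

Record rees := Rees { rees_val : {poly R}; _ : rees_val \in rees_pred }.

HB.instance Definition _ := [isSub for rees_val].
HB.instance Definition _ := [Choice of rees by <:].
HB.instance Definition _ := [SubChoice_isSubComNzRing of rees by <:].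

End Rees.

Section FiberRing.
Variables (K : fieldType) (N : nat) (I : {pred {mpoly K[N]}}).

Definition irrelevant_ideal : {pred {mpoly K[N]}} :=
  gen_ideal [pred p | [exists i : 'I_N, p == 'X_i]].

(* \bigoplus_r m I^r inside \bigoplus_r I^r, m being the irrelevant ideal *)
Definition fiber_ideal : {pred rees I} := [pred p : rees I |
  `[< forall r, (val p)`_r \in ideal_mul irrelevant_ideal (ideal_exp I r) >]].

Lemma fiber_ideal_closed : idealr_closed fiber_ideal.
Proof.
have idm r : is_ideal (ideal_mul irrelevant_ideal (ideal_exp I r)).
  exact: gen_ideal_is_ideal.
split.
- by apply/asboolP=> r; rewrite (raddf0 val) coef0; case: (idm r).
- apply/asboolP=> /(_ 0%N); rewrite (rmorph1 val) coef1 /= => m1.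
  pose Z : {pred {mpoly K[N]}} := [pred p | p.@[fun=> 0] == 0].
  have idZ : is_ideal Z.
    split=> [|a u v]; rewrite !inE ?meval0 //.
    by move=> /eqP u0 /eqP v0; rewrite mevalD mevalM u0 v0 mulr0 addr0.
  suff /(_ 1 m1): {subset ideal_mul irrelevant_ideal predT <= Z}.
    by rewrite inE meval1 oner_eq0.
  apply: gen_ideal_min => // _ /asboolP[a [b [am _ ->]]].
  rewrite mulrC; apply: is_idealMl => //.
  move: a am; apply: gen_ideal_min => // p /existsP[i /eqP->].
  by rewrite inE mevalXU.
- move=> a u v /asboolP uJ /asboolP vJ; apply/asboolP=> r.
  rewrite (rmorphD val) coefD (rmorphM val) coefM /=; apply: is_idealD => //.
  apply: is_ideal_sum => // i; have /asboolP aI := valP a.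
  apply: ideal_mul_colon (uJ _) => // x y xm yI.
  rewrite mulrCA mem_ideal_mul //.
  by have := ideal_expD (aI i) yI; rewrite subnKC // -ltnS.
Qed.

HB.instance Definition _ :=
  isIdealr.Build (rees I) fiber_ideal fiber_ideal_closed.

Definition fiber_ring : comNzRingType := {ideal_quot fiber_ideal}.

Definition has_analytic_spread (l : nat) : Prop := has_krull_dim fiber_ring l.

End FiberRing.

(* The variable x_(i+1) is 'X_i, with i : 'I_N: ordinals are shifted by one   *)
(* with respect to the usual numbering x_1, ..., x_N of the variables.        *)
Section SquarefreeMonomials.
Variable N : nat.
Implicit Types (u v : 'X_{1..N}) (B : {set 'I_N}).

Definition supp u : {set 'I_N} := [set i | (0 < u i)%N].

Definition squarefree u : bool := [forall i, (u i <= 1)%N].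

(* one-based: the largest k such that x_k divides u (0 if u = 1) *)
Definition max_supp u : nat := \max_(i in supp u) i.+1.

Definition consecutive B : bool :=
  [forall i in B, forall j in B, forall k : 'I_N,
     ((i <= k) && (k <= j))%N ==> (k \in B)].

Definition block u B : bool := (B \subset supp u) && consecutive B.

Definition block_decomposition u : {set {set 'I_N}} :=
  [set B | maxset (block u) B].

(* the maximal block containing min (supp u) (empty if u = 1) *)
Definition first_block u : {set 'I_N} :=
  if [pick i in supp u | [forall j in supp u, (i <= j)%N]] is Some i
  then pblock (block_decomposition u) i else set0.

End SquarefreeMonomials.

Section SquarefreeBorel.
Variables (K : fieldType) (N : nat).
Implicit Types I J : {pred {mpoly K[N]}}.

Definition squarefree_monomial_ideal I : Prop :=
  exists2 S : {pred 'X_{1..N}},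
    {in S, forall u, squarefree u}
    & I =i gen_ideal [pred p | `[< exists2 u, u \in S & p = 'X_[u] >]].

Definition squarefree_borel I : Prop :=
  squarefree_monomial_ideal I /\
  forall (u : 'X_{1..N}) (i j : 'I_N),
    squarefree u -> 'X_[u] \in I -> j \in supp u -> (i < j)%N ->
    let v := (U_(i) + (u - U_(j)))%MM in
    squarefree v -> 'X_[v] \in I.

Definition borel_generated m (u : 'I_m -> 'X_{1..N}) I : Prop :=
  [/\ squarefree_borel I,
      forall k, 'X_[u k] \in I
    & forall J, squarefree_borel J -> (forall k, 'X_[u k] \in J) ->
        {subset I <= J}].

End SquarefreeBorel.

(* Main.v *)
Require Import Defs.
From HB Require Import structures.
From mathcomp Require Import all_boot all_order all_algebra.
From mathcomp Require Import ring_quotient boolp.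
From mathcomp Require Import mpoly zify.

Set Implicit Arguments.
Unset Strict Implicit.
Unset Printing Implicit Defensive.

Import GRing.Theory.

(** Indices are counted from 0, so that the variables are x_0, ..., x_(N-1).
    Let b be the largest integer such that x_0, ..., x_(b-1) divide all the
    Borel generators; the exceptional case of the formula is b > 0, where the
    intersection of the first blocks is {0, ..., b-1}, and the claim is that
    the analytic spread is n - b in all cases.  As I is not principal, b < d < n.
    The ideal I is generated by the squarefree monomials of degree d that it
    contains (borel_sets_gen); their supports form a family F of d-subsets of
    {0, ..., n-1} containing {0, ..., b-1} and stable under the replacement of
    an element by a smaller one.  The fiber ring is the monomial algebra K[F],
    of dimension n - b, but the proof never makes this identification: the
    primes of the fiber ring are the primes of the Rees algebra that contain
    the fiber ideal (has_krull_dim_quot), and an element p of the Rees algebra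
    lies in the fiber ideal as soon as, for all r, its coefficient of t^r has no
    monomial of degree d * r (mem_irrelevant_exp).

    Lower bound.  Give positive weights w to the variables, and let c be at
    most the weight of every generator.  The elements of the Rees algebra whose
    coefficient of t^r has no component of weight c * r, for all r, form a prime
    containing the fiber ideal (weight_prime_is_prime), which depends only on
    the face formed by the generators of weight c, and decreases strictly when
    the face increases (weight_prime_chain).  For b <= i <= d < k, the sets
    of F between {0, ..., i-1} and {0, ..., k-1} form such a face.  Starting
    from (i, k) = (b, n), decreasing k down to d + 1, then increasing i up to d,
    and ending with the empty face gives n - b + 1 strictly decreasing faces.
    They are distinct because F contains {0, ..., d-2, k} for d < k < n
    and {0, ..., d} minus i for b <= i <= d, by the lemma exchange.

    Upper bound.  The monomials of degree d * r of I^r are determined by their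
    exponents at b, ..., n-1, which are at most r.  By counting monomials, any
    e > n - b elements of the Rees algebra satisfy a nonzero polynomial
    relation over K modulo the fiber ideal.  No such relation can hold between
    elements f_k in P_(k+1) but not in P_k of a chain of primes, as one sees by
    factoring out its lexicographically smallest monomial (prime_chain_free);
    hence chains have length at most n - b. *)

(** * Chains of primes *)

Section PrimeChains.
Local Open Scope ring_scope.
Variable A : comNzRingType.
Implicit Types (P J : {pred A}).

Lemma is_primeMl P a x : is_prime P -> x \in P -> a * x \in P.
Proof. by case=> -[P0 _ PD] _ xP; rewrite -[a * x]addr0 PD. Qed.

Lemma is_primeD P x y : is_prime P -> x \in P -> y \in P -> x + y \in P.
Proof. by case=> -[_ _ PD] _ xP yP; rewrite -[x]mul1r PD. Qed.

Lemma is_primeB P x y : is_prime P -> x \in P -> y \in P -> x - y \in P.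
Proof.
by move=> Pp xP yP; rewrite addrC -mulN1r; case: Pp => -[_ _ PD] _; apply: PD.
Qed.

Lemma is_prime_sum P (T : Type) (r : seq T) (p : pred T) (F : T -> A) :
  is_prime P -> (forall i, p i -> F i \in P) -> \sum_(i <- r | p i) F i \in P.
Proof.
move=> Pp FP; apply: (big_ind (fun x => x \in P)) => //; first by case: Pp => -[].
by move=> x y; apply: is_primeD.
Qed.

Lemma is_primeX P x k : is_prime P -> x \notin P -> x ^+ k \notin P.
Proof.
move=> Pp xP; elim: k => [|k IHk]; first by case: Pp => -[].
by apply/negP; rewrite exprS => /(proj2 Pp); rewrite (negPf xP) (negPf IHk).
Qed.

(** For a strictly increasing chain, a polynomial relation with unit
    coefficients between witnesses of strictness is impossible: divide the
    relation by the lexicographically smallest monomial that occurs in it. *)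
Lemma prime_chain_free e (P : 'I_e.+1 -> {pred A}) S (f : 'I_e -> A)
    (Z : {set {ffun 'I_e -> 'I_S}}) (c : {ffun 'I_e -> 'I_S} -> A) :
    prime_chain P ->
    (forall k, f k \in P (lift ord0 k)) ->
    (forall k, f k \notin P (widen_ord (leqnSn e) k)) ->
    Z != set0 -> {in Z, forall a, exists b, b * c a = 1} ->
  \sum_(a in Z) c a * \prod_(i < e) f i ^+ a i \notin P ord0.
Proof.
move=> [Pprime Pincl] fP fNP Z0 cU; apply/negP=> relP.
(* W gathers the monomials that are smallest in the first k variables. *)
suff red k (hk : (k < e.+1)%N) : exists W : {set {ffun 'I_e -> 'I_S}},
    [/\ W \subset Z, W != set0,
        {in W &, forall a b : {ffun 'I_e -> 'I_S}, forall i : 'I_e, (i < k)%N -> a i = b i}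
      & \sum_(a in W) c a * \prod_(i < e | (k <= i)%N) f i ^+ a i
          \in P (Ordinal hk)].
  have [W [/subsetP WZ /set0Pn[a aW] Weq]] := red e (ltnSn e).
  have -> : W = [set a].
    apply/setP=> b; rewrite inE; apply/idP/eqP => [bW|->//].
    by apply/ffunP=> i; apply: Weq.
  rewrite big_set1 big_pred0 => [|i]; last by rewrite leqNgt ltn_ord.
  rewrite mulr1 => cP; have [b bc] := cU _ (WZ _ aW).
  have := is_primeMl b (Pprime _) cP; rewrite bc.
  by apply/negP; case: (Pprime (Ordinal (ltnSn e))) => -[].
elim: k hk => [|k IHk] hk.
  exists Z; split=> //; rewrite (_ : Ordinal hk = ord0); last exact: val_inj.
  by congr (_ \in P _): relP; apply: eq_bigr => a _; congr (_ * _); apply: eq_bigl.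
have [W [WZ /set0Pn[a0 a0W] Weq relW]] := IHk (ltnW hk).
pose ke : 'I_e := Ordinal (hk : (k < e)%N).
have [a1 a1W a1min] := @arg_minnP _ a0 (fun a => a \in W) (fun a => a ke) a0W.
exists [set a in W | a ke == a1 ke]; split.
- by apply/subsetP=> a; rewrite inE => /andP[/(subsetP WZ)].
- by apply/set0Pn; exists a1; rewrite inE a1W eqxx.
- move=> a b; rewrite !inE => /andP[aW /eqP aE] /andP[bW /eqP bE] i.
  rewrite ltnS leq_eqVlt => /predU1P[ik|]; last exact: Weq.
  by rewrite (_ : i = ke) ?aE ?bE //; apply: val_inj.
pose rest a := c a * \prod_(i < e | (k < i)%N) f i ^+ a i.
have relE : \sum_(a in W) c a * \prod_(i < e | (k <= i)%N) f i ^+ a i =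
    f ke ^+ a1 ke * \sum_(a in W) f ke ^+ (a ke - a1 ke) * rest a.
  rewrite mulr_sumr; apply: eq_bigr => a aW; rewrite (bigD1 ke) //= mulrA.
  rewrite -exprD subnKC ?a1min // mulrCA; congr (_ * (_ * _)).
  by apply: eq_bigl => i; rewrite ltn_neqAle andbC eq_sym.
have wk : Ordinal (ltnW hk) = widen_ord (leqnSn e) ke by apply: val_inj.
have lk : Ordinal hk = lift ord0 ke by apply: val_inj.
have relD : \sum_(a in W) f ke ^+ (a ke - a1 ke) * rest a \in P (Ordinal hk).
  have [sub _] := Pincl (Ordinal (ltnW hk)) (Ordinal hk) (ltnSn k).
  apply: sub; move: relW; rewrite relE => /(proj2 (Pprime _)) /orP[fX|//].
  by have := is_primeX (a1 ke) (Pprime _) (fNP ke); rewrite -wk fX.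
have -> : \sum_(a in [set a in W | a ke == a1 ke]) rest a =
    \sum_(a in W) f ke ^+ (a ke - a1 ke) * rest a -
    \sum_(a in W | a ke != a1 ke) f ke ^+ (a ke - a1 ke) * rest a.
  rewrite [X in X - _](bigID (fun a : {ffun _} => a ke == a1 ke)) /= addrK.
  rewrite big_set /=; apply: eq_big => [a|a /andP[_ /eqP->]] //.
  by rewrite subnn expr0 mul1r.
apply: is_primeB => //; apply: is_prime_sum => // a /andP[aW ane].
rewrite -(@prednK (a ke - a1 ke)) ?subn_gt0; last first.
  by rewrite ltn_neqAle eq_sym ane a1min.
by rewrite exprSr -mulrA mulrCA mulrC; apply: is_primeMl => //; rewrite lk; apply: fP.
Qed.

End PrimeChains.

Section QuotientDim.
Local Open Scope ring_scope.
Local Open Scope quotient_scope.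
Variables (A : comNzRingType) (J : idealr A).
Local Notation Q := {ideal_quot J}.

Lemma pi_eq0 (x : A) : x \in J -> \pi_Q x = 0 :> Q.
Proof.
move=> xJ; rewrite -(raddf0 (\pi_Q : A -> Q)).
by apply/eqP; rewrite -Quotient.idealrBE subr0.
Qed.

(** The primes of a quotient by [J] are the primes that contain [J]. *)
Lemma has_krull_dim_quot d :
    (exists2 P : 'I_d.+1 -> {pred A}, prime_chain P &
       forall i, {subset J <= P i}) ->
    (forall e (P : 'I_e.+1 -> {pred A}), prime_chain P ->
       {subset J <= P ord0} -> (e <= d)%N) ->
  has_krull_dim Q d.
Proof.
move=> [P [Pprime Pincl] JP] ub; split.
  have piP i x : (repr (\pi_Q x) \in P i) = (x \in P i).
    have sJ : repr (\pi_Q x) - x \in P i by apply: JP; rewrite Quotient.idealrBE reprK.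
    apply/idP/idP => xP.
      by rewrite -[x](subKr (repr (\pi_Q x))); apply: is_primeB.
    by rewrite -[repr _](subrK x); apply: is_primeD.
  exists (fun i => [pred x : Q | repr x \in P i] : {pred Q}).
  split=> [i|i j /Pincl[Pij NPji]].
    split; [split|].
    - by rewrite inE -(raddf0 (\pi_Q : A -> Q)) piP; case: (Pprime i) => -[].
    - by rewrite inE -(rmorph1 (\pi_Q : A -> Q)) piP; case: (Pprime i) => -[].
    - move=> a u v; rewrite -[a]reprK -[u]reprK -[v]reprK -rmorphM -rmorphD !inE !piP.
      by case: (Pprime i) => -[_ _ PD] _; apply: PD.
    - move=> u v; rewrite -[u]reprK -[v]reprK -rmorphM !inE !piP.
      exact: (proj2 (Pprime i)).
  split=> [x|sub]; first exact: Pij.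
  by apply: NPji => x xPj; rewrite -piP; apply: sub; rewrite inE piP.
move=> e P' [Pprime' Pincl'];
apply: (ub e (fun i => [pred x | \pi_Q x \in P' i] : {pred A})).
  split=> [i|i j /Pincl'[Pij NPji]].
    split; [split|].
    - by rewrite inE rmorph0; case: (Pprime' i) => -[].
    - by rewrite inE rmorph1; case: (Pprime' i) => -[].
    - move=> a u v; rewrite !inE rmorphD rmorphM.
      by case: (Pprime' i) => -[_ _ PD] _; apply: PD.
    - by move=> u v; rewrite !inE rmorphM; apply: (proj2 (Pprime' i)).
  split=> [x|sub]; first exact: Pij.
  by apply: NPji => x; rewrite -[x]reprK => /(sub (repr x)).
by move=> x xJ; rewrite inE pi_eq0 //; case: (Pprime' ord0) => -[].
Qed.

End QuotientDim.

(** * Rees algebras of ideals generated by monomials *)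

Section MonomialIdeals.
Local Open Scope ring_scope.
Variables (K : fieldType) (N : nat).
Implicit Types (Gen : {pred 'X_{1..N}}) (m : 'X_{1..N}) (p : {mpoly K[N]}).

(** The ideal generated by the monomials with exponents in [Gen]. *)
Definition monomial_ideal Gen : {pred {mpoly K[N]}} :=
  gen_ideal [pred p | `[< exists2 u, u \in Gen & p = 'X_[u] >]].

(** [m] is divisible by a product of [r] elements of [Gen]. *)
Definition in_power Gen r m : Prop :=
  exists2 s : seq 'X_{1..N}, size s = r /\ {subset s <= Gen}
    & ((\big[+%MM/0%MM]_(g <- s) g) <= m)%MM.

Lemma is_ideal_msupp (U : 'X_{1..N} -> Prop) :
    (forall m m', (m <= m')%MM -> U m -> U m') ->
  is_ideal [pred p : {mpoly K[N]} | `[< forall m, m \in msupp p -> U m >]].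
Proof.
move=> Uup; split; first by apply/asboolP=> m; rewrite msupp0.
move=> a p q /asboolP pU /asboolP qU; apply/asboolP=> m /msuppD_le.
rewrite mem_cat => /orP[/msuppM_le|/qU//] /allpairsP[[m1 m2] /= [_ m2p ->]].
exact: Uup (lem_addl _ _) (pU _ m2p).
Qed.

Lemma in_power_le Gen r m m' : (m <= m')%MM -> in_power Gen r m -> in_power Gen r m'.
Proof. by move=> mm' [s sG sm]; exists s => //; apply: lepm_trans mm'. Qed.

Lemma monomial_idealP Gen p m :
  p \in monomial_ideal Gen -> m \in msupp p -> exists2 g, g \in Gen & (g <= m)%MM.
Proof.
pose U m := exists2 g, g \in Gen & (g <= m)%MM.
have Uup m1 m2 : (m1 <= m2)%MM -> U m1 -> U m2.
  by move=> le12 [g gG gm]; exists g => //; apply: lepm_trans le12.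
move=> pI mp.
have /(_ p pI)/asboolP : {subset monomial_ideal Gen <= [pred p : {mpoly K[N]}
    | `[< forall m, m \in msupp p -> U m >]]}; last exact.
apply: gen_ideal_min; first exact: is_ideal_msupp.
move=> _ /asboolP[u uG ->]; apply/asboolP=> m'.
by rewrite msuppX inE => /eqP->; exists u => //; apply: lepm_refl.
Qed.

Lemma mem_monomial_ideal Gen m :
  ('X_[m] \in monomial_ideal Gen) = `[< exists2 g, g \in Gen & (g <= m)%MM >].
Proof.
apply/idP/asboolP=> [/monomial_idealP|[g gG gm]]; first by apply; rewrite msuppX inE.
rewrite -(submK gm) mpolyXD; apply: is_idealMl; first exact: gen_ideal_is_ideal.
by apply/mem_gen_ideal/asboolP; exists g.
Qed.

Section Powers.
Variables (Gen : {pred 'X_{1..N}}) (I : {pred {mpoly K[N]}}).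
Hypothesis I_gen : I =i monomial_ideal Gen.

Lemma ideal_exp_msupp r p m :
  p \in ideal_exp I r -> m \in msupp p -> in_power Gen r m.
Proof.
elim: r p m => [|r IHr] p m pI mp.
  by exists [::] => //; rewrite big_nil; apply/mnm_lepP => i; rewrite mnm0E.
have /(_ p pI)/asboolP : {subset ideal_exp I r.+1 <= [pred p : {mpoly K[N]}
    | `[< forall m, m \in msupp p -> in_power Gen r.+1 m >]]}; last exact.
apply: gen_ideal_min; first by apply: is_ideal_msupp => ? ?; apply: in_power_le.
move=> _ /asboolP[a [b [aI bI ->]]]; apply/asboolP=> m' /msuppM_le.
move=> /allpairsP[[m1 m2] /= [m1a /(IHr _ _ bI)[s [sr sG] sm] ->]].
have [g gG gm] : exists2 g, g \in Gen & (g <= m1)%MM.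
  by apply: (@monomial_idealP _ a) => //; rewrite -I_gen.
exists (g :: s) => /=; last rewrite big_cons.
  by split=> [|x]; rewrite ?sr // inE => /predU1P[->//|/sG].
apply/mnm_lepP => i; rewrite !mnmDE; apply: leq_add; exact: mnm_lepP.
Qed.

Lemma mem_ideal_exp r m : in_power Gen r m -> 'X_[m] \in ideal_exp I r.
Proof.
case=> s [sr sG] sm; rewrite -(submK sm) mpolyXD.
apply: is_idealMl; first exact: ideal_exp_is_ideal.
elim: s r sr sG {m sm} => [|g s IHs] [] //= r [sr] sG.
have gG : g \in Gen by apply: sG; rewrite mem_head.
rewrite big_cons mpolyXD mem_ideal_mul //; last first.
  by apply: IHs => // x xs; apply: sG; rewrite inE xs orbT.
rewrite I_gen mem_monomial_ideal.
by apply/asboolP; exists g => //; apply: lepm_refl.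
Qed.

(** If [Gen] lies in degree [d], the generators of [I^r] have degree [d * r]:
    an element of [I^r] without monomials of that degree lies in the product of
    [I^r] with the irrelevant ideal. *)
Lemma mem_irrelevant_exp d r p : {in Gen, forall g, mdeg g = d} ->
    p \in ideal_exp I r -> (forall m, mdeg m = (d * r)%N -> p@_m = 0) ->
  p \in ideal_mul (@irrelevant_ideal K N) (ideal_exp I r).
Proof.
move=> Gd pI p0; rewrite [p]mpolyE big_seq.
have idJ : is_ideal (ideal_mul (@irrelevant_ideal K N) (ideal_exp I r)).
  exact: gen_ideal_is_ideal.
apply: (big_ind (fun q => q \in ideal_mul _ _)); first by case: idJ.
  by move=> x y; apply: is_idealD.
move=> m mp; have [s [sr sG] sm] := ideal_exp_msupp pI mp.
have /eqP : mdeg (m - \big[+%MM/0%MM]_(g <- s) g)%MM != 0%N.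
  apply: contraL mp => /eqP m0; rewrite mcoeff_msupp negbK; apply/eqP/p0.
  rewrite -(submK sm) mdegD m0 mdeg_sum -sr (eq_big_seq (fun=> d)).
    by rewrite big_const_seq count_predT iter_addn_0.
  by move=> g /sG/Gd.
set m' := (m - _)%MM; move/eqP; rewrite mdeg_eq0 => m'0.
have /existsP[i m'i] : [exists i, m' i != 0%N].
  apply: contraR m'0; rewrite negb_exists => /forallP m'0.
  by apply/eqP/mnmP => i; rewrite mnm0E; apply/eqP; have := m'0 i; rewrite negbK.
have Uim' : (U_(i) <= m')%MM by rewrite lep1mP.
rewrite -mul_mpolyC; apply: is_idealMl => //.
rewrite -(submK sm) -/m' -(submK Uim') [(_ - U_(i) + _)%MM]addmC -addmA mpolyXD.
apply: mem_ideal_mul; first by apply: mem_gen_ideal; apply/existsP; exists i.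
by apply: mem_ideal_exp; exists s => //; apply: lem_addl.
Qed.

End Powers.
End MonomialIdeals.

(** * Primes of the Rees algebra defined by weights *)

Section Weights.
Local Open Scope ring_scope.
Variables (K : fieldType) (N : nat) (w : 'I_N -> nat).
Implicit Types (m : 'X_{1..N}) (p : {mpoly K[N]}).

(** The degree of the monomial with exponents [m] when [x_i] has degree
    [w i]. *)
Definition weight m : nat := \sum_i w i * m i.

Lemma weight0 : weight 0%MM = 0%N.
Proof. by rewrite /weight big1 // => i _; rewrite mnm0E muln0. Qed.

Lemma weightD m1 m2 : weight (m1 + m2)%MM = (weight m1 + weight m2)%N.
Proof. by rewrite -big_split /=; apply: eq_bigr => i _; rewrite mnmDE mulnDr. Qed.

Lemma weight_sum s : weight (\big[+%MM/0%MM]_(g <- s) g) = (\sum_(g <- s) weight g)%N.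
Proof. exact: (big_morph weight weightD weight0). Qed.

Lemma weight_eq0 m : (forall i, 0 < w i)%N -> (weight m == 0%N) = (m == 0%MM).
Proof.
move=> w0; apply/eqP/eqP=> [|->]; last exact: weight0.
move/eqP; rewrite sum_nat_eq0 => /forallP m0; apply/mnmP => i; rewrite mnm0E.
by have := m0 i; rewrite muln_eq0 gtn_eqF ?w0 // => /eqP.
Qed.

Fact weight_subst_key : unit. Proof. by []. Qed.

(** The substitution [x_i := x_i * s ^ w_i], where [s] is the outer variable;
    the coefficient of [s ^ k] is the component of weight [k]. It is locked to
    keep unification from unfolding it. *)
Definition weight_subst : {mpoly K[N]} -> {poly {mpoly K[N]}} :=
  locked_with weight_subst_key
    (mmap (polyC \o @mpolyC N K) (fun i => ('X_i)%:P * 'X^(w i))).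

Lemma weight_subst_is_zmod_morphism : zmod_morphism weight_subst.
Proof. by rewrite [weight_subst]unlock => p q; apply: raddfB. Qed.

Lemma weight_subst_is_monoid_morphism : monoid_morphism weight_subst.
Proof. by rewrite [weight_subst]unlock; split=> [|p q]; rewrite ?rmorph1 ?rmorphM. Qed.

HB.instance Definition _ := GRing.isZmodMorphism.Build {mpoly K[N]}
  {poly {mpoly K[N]}} weight_subst weight_subst_is_zmod_morphism.
HB.instance Definition _ := GRing.isMonoidMorphism.Build {mpoly K[N]}
  {poly {mpoly K[N]}} weight_subst weight_subst_is_monoid_morphism.

Lemma weight_substX m : weight_subst 'X_[m] = ('X_[m])%:P * 'X^(weight m).
Proof.
rewrite [weight_subst]unlock mmapX /mmap1 mpolyXE_id rmorph_prod /= /weight -prodrXr.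
by rewrite -big_split; apply: eq_bigr => i _; rewrite exprMn rmorphXn exprM.
Qed.

Lemma coef_weight_subst p k m :
  ((weight_subst p)`_k)@_m = if weight m == k then p@_m else 0.
Proof.
rewrite {1}[p]mpolyE raddf_sum /= coef_sum raddf_sum /=.
transitivity (\sum_(m' <- msupp p) p@_m' * ('X_[m'])@_m *+ (k == weight m')).
  apply: eq_bigr => m' _; rewrite -mul_mpolyC rmorphM /= weight_substX.
  rewrite [weight_subst]unlock mmapC /=.
  rewrite mulrA -rmorphM coefCM coefXn.
  by rewrite -mulrnAr mulr_natr raddfMn /= mcoeffCM mulrnAr.
rewrite [in RHS](mpolyE p) raddf_sum /=; case: ifP => [/eqP wm|wm].
  apply: eq_bigr => m' _; rewrite mcoeffZ mcoeffX.
  by have [->|] := eqVneq m' m; rewrite ?wm ?eqxx // mulr0 mul0rn.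
rewrite big1 // => m' _; rewrite mcoeffX; have [->|_] := eqVneq m' m.
  by rewrite eq_sym wm.
by rewrite mulr0 mul0rn.
Qed.

Section WeightPrime.
Variables (Gen : {pred 'X_{1..N}}) (I : {pred {mpoly K[N]}}) (c : nat).
Hypothesis I_gen : I =i monomial_ideal Gen.
Hypothesis w_Gen : {in Gen, forall g, (c <= weight g)%N}.

(** The ideal of the [p] such that, for all [r], the coefficient of [t ^ r] in
    [p] has no component of weight [c * r], a lower bound for the weights of
    the monomials in [I^r]. *)
Definition weight_prime : {pred rees I} := [pred p : rees I |
  `[< forall r m, weight m = (c * r)%N -> ((val p)`_r)@_m = 0 >]].

Lemma in_power_weight r m : in_power Gen r m -> (c * r <= weight m)%N.
Proof.
case=> s [<- sG] sm; rewrite -(submK sm) weightD weight_sum.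
apply: leq_trans (leq_addl _ _); rewrite -sum1_size big_distrr /= !big_seq.
by apply: leq_sum => g /sG/w_Gen; rewrite muln1.
Qed.

(** The sum over [r] of the component of weight [c * r] of the coefficient of
    [t ^ r]; it is multiplicative on the Rees algebra, with kernel
    [weight_prime]. *)
Definition weight_initial (p : {poly {mpoly K[N]}}) : {poly {mpoly K[N]}} :=
  \poly_(r < size p) (weight_subst p`_r)`_(c * r).

Lemma coef_weight_initial (p : {poly {mpoly K[N]}}) r :
  (weight_initial p)`_r = (weight_subst p`_r)`_(c * r).
Proof.
rewrite coef_poly; case: ltnP => // /(nth_default 0) ->.
by rewrite raddf0 coef0.
Qed.

Lemma weight_primeP (p : rees I) :
  reflect (weight_initial (val p) = 0) (p \in weight_prime).
Proof.
apply: (iffP (asboolP _)) => [p0|p0 r m wm].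
  apply/polyP=> r; rewrite coef_weight_initial coef0; apply/mpolyP=> m.
  by rewrite coef_weight_subst mcoeff0; case: eqP => // /p0.
by have := coef_weight_subst (val p)`_r (c * r) m;
  rewrite -coef_weight_initial p0 coef0 mcoeff0 wm eqxx.
Qed.

Lemma weight_initialD (p q : {poly {mpoly K[N]}}) :
  weight_initial (p + q) = weight_initial p + weight_initial q.
Proof.
apply/polyP=> r; rewrite coef_weight_initial.
rewrite (coefD (weight_initial p)).
rewrite (coef_weight_initial p) (coef_weight_initial q) (coefD p q r).
rewrite raddfD.
by rewrite coefD.
Qed.

Lemma weight_subst_low r p j :
  p \in ideal_exp I r -> (j < c * r)%N -> (weight_subst p)`_j = 0.
Proof.
move=> pI jr; apply/mpolyP=> m; rewrite coef_weight_subst mcoeff0.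
case: eqP => // wm; apply/eqP; rewrite mcoeff_eq0; apply: contraL jr => mp.
by rewrite -leqNgt -wm; apply/in_power_weight/(ideal_exp_msupp I_gen pI mp).
Qed.

Lemma weight_initialM (p q : rees I) :
  weight_initial (val (p * q)) = weight_initial (val p) * weight_initial (val q).
Proof.
have coefM_low (a b : {poly {mpoly K[N]}}) s t :
    (forall j, (j < s)%N -> a`_j = 0) -> (forall j, (j < t)%N -> b`_j = 0) ->
    (a * b)`_(s + t) = a`_s * b`_t.
  move=> a0 b0; rewrite coefM (bigD1 (inord s)) //= inordK ?ltnS ?leq_addr //.
  rewrite addKn big1 ?addr0 // => j jne.
  have [/a0->|sj] := ltnP j s; first by rewrite mul0r.
  rewrite b0 ?mulr0 // -ltnS; have : (j != s :> nat).
    by apply: contra jne => /eqP js; apply/eqP/val_inj; rewrite /= inordK ?js ?ltnS ?leq_addr.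
  by have := ltn_ord j; lia.
have /asboolP pI := valP p; have /asboolP qI := valP q.
apply/polyP=> r; rewrite coef_weight_initial rmorphM !coefM.
rewrite raddf_sum coef_sum /=; apply: eq_bigr => i _.
rewrite rmorphM /= !coef_weight_initial.
have -> : (c * r = c * i + c * (r - i))%N by rewrite -mulnDr subnKC // -ltnS.
by apply: coefM_low => j; apply: weight_subst_low.
Qed.

Lemma weight_prime_is_prime : is_prime weight_prime.
Proof.
have init0 : weight_initial 0 = 0 by apply/polyP=> r; rewrite coef_poly size_poly0 coef0.
have init1 : weight_initial 1 = 1.
  apply/polyP=> r; rewrite coef_weight_initial !coef1; case: r => [|r] /=.
    by rewrite muln0 rmorph1 coef1.
  by rewrite raddf0 coef0.
split; [split|].
- by apply/weight_primeP; rewrite raddf0.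
- by apply/weight_primeP; rewrite rmorph1 init1; apply/eqP/oner_neq0.
- move=> a u v /weight_primeP u0 /weight_primeP v0; apply/weight_primeP.
  by rewrite rmorphD weight_initialD weight_initialM u0 v0 mulr0 addr0.
- move=> u v /weight_primeP/eqP; rewrite weight_initialM mulf_eq0.
  by case/orP=> /eqP uv; apply/orP; [left|right]; apply/weight_primeP.
Qed.

Hypothesis w_gt0 : forall i, (0 < w i)%N.

Lemma fiber_ideal_weight_prime : {subset @fiber_ideal K N I <= weight_prime}.
Proof.
move=> p /asboolP pJ; apply/asboolP=> r m wm.
pose U m := (c * r < weight m)%N.
have Uup m1 m2 : (m1 <= m2)%MM -> U m1 -> U m2.
  by move=> le12 /leq_trans; apply; rewrite -(submK le12) weightD leq_addl.
suff sub : {subset ideal_mul (@irrelevant_ideal K N) (ideal_exp I r) <=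
    [pred p : {mpoly K[N]} | `[< forall m, m \in msupp p -> U m >]]}.
  apply/eqP; rewrite mcoeff_eq0; apply/negP => mp.
  by have /asboolP/(_ m mp) := sub _ (pJ r); rewrite /U wm ltnn.
apply: gen_ideal_min; first exact: is_ideal_msupp.
move=> _ /asboolP[a [b [aI bI ->]]]; apply/asboolP=> m' /msuppM_le.
move=> /allpairsP[[m1 m2] /= [m1a m2b ->]]; rewrite /U weightD.
have := in_power_weight (ideal_exp_msupp I_gen bI m2b).
suff : (0 < weight m1)%N by lia.
pose V m := (0 < weight m)%N.
have Vup m3 m4 : (m3 <= m4)%MM -> V m3 -> V m4.
  by move=> le34 /leq_trans; apply; rewrite -(submK le34) weightD leq_addl.
have /(_ a aI)/asboolP/(_ m1 m1a) : {subset @irrelevant_ideal K N <=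
    [pred p : {mpoly K[N]} | `[< forall m, m \in msupp p -> V m >]]}; last exact.
apply: gen_ideal_min; first exact: is_ideal_msupp.
move=> _ /existsP[i /eqP->]; apply/asboolP=> m3.
rewrite msuppX inE => /eqP->; rewrite /V lt0n weight_eq0 //.
by rewrite -mdeg_eq0 mdeg1.
Qed.

End WeightPrime.
End Weights.

(** * A lower bound for the analytic spread *)

Section WeightChain.
Local Open Scope ring_scope.
Variables (K : fieldType) (N : nat) (Gen : {pred 'X_{1..N}}).
Variable I : {pred {mpoly K[N]}}.
Hypothesis I_gen : I =i monomial_ideal Gen.

(** Decreasing faces, where face [i] consists of the generators of weight
    [c i] for [w i], and a generator [g i] of face [i] outside the later faces
    yield a chain of primes. *)
Lemma weight_prime_chain e (w : nat -> 'I_N -> nat) (c : nat -> nat)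
    (g : nat -> 'X_{1..N}) :
    (forall i j, 0 < w i j)%N ->
    (forall i, (i <= e)%N -> {in Gen, forall h, (c i <= weight (w i) h)%N}) ->
    (forall i j, (i < j <= e)%N ->
       {in Gen, forall h, weight (w j) h = c j -> weight (w i) h = c i}) ->
    (forall i, (i < e)%N -> g i \in Gen /\ weight (w i) (g i) = c i) ->
    (forall i j, (i < j <= e)%N -> weight (w j) (g i) <> c j) ->
  prime_chain (fun i : 'I_e.+1 => weight_prime (I := I) (w i) (c i)).
Proof.
move=> w0 cw face gG gN; split=> [i|i j ij].
  by apply: weight_prime_is_prime I_gen _; apply: cw; rewrite -ltnS.
have je : (i < j <= e)%N by rewrite ij -ltnS ltn_ord.
have ie : (i < e)%N by case/andP: je => /leq_trans; apply.
split=> [p /asboolP pi|sub].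
  apply/asboolP=> r m wm; apply/eqP; rewrite mcoeff_eq0; apply/negP => mp.
  suff : weight (w i) m = (c i * r)%N.
    by move/pi/eqP; rewrite mcoeff_eq0 mp.
  have /asboolP/(_ r)/(ideal_exp_msupp I_gen)/(_ mp) [s [sr sG] sm] := valP p.
  have wi := cw j (proj2 (andP je)).
  (* As [m] has the smallest weight [c j * r], it is a product of [r]
     generators, each of weight [c j]. *)
  have ws : (\sum_(h <- s) c j <= \sum_(h <- s) weight (w j) h)%N.
    by rewrite !big_seq; apply: leq_sum => h /sG; apply: wi.
  have cs k : (\sum_(h <- s) c k = c k * r)%N.
    by rewrite big_const_seq count_predT iter_addn_0 sr.
  move: wm; rewrite -(submK sm) !weightD !weight_sum => wm.
  have m0 : weight (w j) (m - \big[+%MM/0%MM]_(h <- s) h)%MM == 0%N.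
    by rewrite -leqn0; move: wm ws; rewrite cs; lia.
  move: wm; rewrite (eqP m0) add0n -cs => wm.
  move: m0; rewrite weight_eq0 // => /eqP->; rewrite weight0 add0n -cs.
  apply: eq_big_seq => h hs; apply: (face i j) => //; first exact: sG.
  apply/eqP; rewrite eqn_leq wi ?sG // andbT leqNgt; apply/negP => lt_h.
  suff : (\sum_(h <- s) c j < \sum_(h <- s) weight (w j) h)%N by rewrite wm ltnn.
  rewrite !(big_rem h hs) /= -addSn leq_add // !big_seq.
  by apply: leq_sum => h' /mem_rem/sG; apply: wi.
have [giG wgi] := gG _ ie.
have giR : ('X_[g i])%:P * 'X \in rees_pred I.
  apply/asboolP => r; rewrite coefMX; case: r => [|[|r]] //=.
    rewrite coefC eqxx; apply: (mem_ideal_exp I_gen (r := 1)); exists [:: g i].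
      by split=> // x; rewrite inE => /eqP->.
    by rewrite big_seq1 lepm_refl.
  by rewrite coefC; case: (ideal_exp_is_ideal I r.+2).
have : Rees giR \in weight_prime (I := I) (w j) (c j).
  apply/asboolP => r m wm /=; rewrite coefMX; case: r wm => [|[|r]] wm /=.
  - by rewrite mcoeff0.
  - rewrite coefC eqxx mcoeffX; case: eqP => // gm.
    by case: (gN i j je); rewrite gm wm muln1.
  - by rewrite coefC mcoeff0.
move/sub/asboolP => /(_ 1%N (g i)); rewrite wgi muln1 => /(_ erefl)/eqP /=.
by rewrite coefMX coefC eqxx mcoeffX eqxx oner_eq0.
Qed.

End WeightChain.

Section SquarefreeSets.
Variable N : nat.
Implicit Types (A : {set 'I_N}) (F : {set {set 'I_N}}).

(** The squarefree monomial with support [A]. *)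
Definition sqmon A : 'X_{1..N} := [multinom (i \in A : nat) | i < N].

Lemma sqmon_inj : injective sqmon.
Proof.
move=> A B /mnmP AB; apply/setP=> i; have := AB i.
by rewrite !mnmE; do 2!case: (i \in _).
Qed.

(** The squarefree monomials with support in the family [F]. *)
Definition sqmons F : {pred 'X_{1..N}} := [pred m | [exists A in F, m == sqmon A]].

Lemma mem_sqmons F A : A \in F -> sqmon A \in sqmons F.
Proof. by move=> AF; apply/existsP; exists A; rewrite AF eqxx. Qed.

Lemma sqmonsP F m : reflect (exists2 A, A \in F & m = sqmon A) (m \in sqmons F).
Proof.
by apply: (iffP existsP) => [[A /andP[AF /eqP]]|[A AF ->]]; exists A; rewrite ?AF ?eqxx.
Qed.

Lemma weight_sqmon w A : weight w (sqmon A) = \sum_(i in A) w i.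
Proof.
rewrite /weight [RHS]big_mkcond /=; apply: eq_bigr => i _; rewrite mnmE.
by case: (i \in A); rewrite (muln0, muln1).
Qed.

Lemma mdeg_sqmon A : mdeg (sqmon A) = #|A|.
Proof.
rewrite mdegE -sum1_card [RHS]big_mkcond /=; apply: eq_bigr => i _; rewrite mnmE.
by case: (i \in A).
Qed.

(** For [i <= d], the sets with [d] elements have weight at least [2 * d - i],
    with equality for those that contain the indices below [i] and have no
    index from [k] on. *)
Definition step_weight i k (j : 'I_N) : nat := 1 + (i <= j) + (k <= j).

Lemma card_ord_lt i : i <= N -> #|[set j : 'I_N | j < i]| = i.
Proof.
move=> iN; rewrite -sum1_card -[RHS]card_ord -[RHS]sum1_card.
rewrite (big_ord_widen N (fun=> 1) iN).
by apply: eq_bigl => j; rewrite inE.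
Qed.

Section StepWeight.
Variables (d i k : nat) (A : {set 'I_N}).
Hypotheses (Ad : #|A| = d) (iN : i <= N).

Let L := [set j : 'I_N | j < i].

Let step_weightE : weight (step_weight i k) (sqmon A) + i =
  2 * d + #|L :\: A| + #|[set j in A | k <= j]|.
Proof.
rewrite weight_sqmon /step_weight !big_split /= sum1_card Ad.
have sumE (p : pred 'I_N) : \sum_(j in A) p j = #|[set j in A | p j]|.
  rewrite -sum1_card big_mkcond [RHS]big_mkcond /=.
  by apply: eq_bigr => j _; rewrite inE; case: (j \in A); case: (p j).
rewrite (sumE (fun j => i <= j)) (sumE (fun j => k <= j)).
have := cardsID L A; rewrite (_ : A :\: L = [set j in A | i <= j]); last first.
  by apply/setP=> j; rewrite !inE -leqNgt andbC.
have := cardsID A L; rewrite card_ord_lt // setIC Ad.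
move: #|A :&: L| #|L :\: A| #|[set j in A | i <= j]| #|[set j in A | k <= j]|.
by move=> x y z t; lia.
Qed.

Lemma step_weight_ge : i <= d -> 2 * d - i <= weight (step_weight i k) (sqmon A).
Proof. by have := step_weightE; lia. Qed.

Lemma step_weight_minP : i <= d ->
  reflect ((forall j : 'I_N, j < i -> j \in A) /\ {in A, forall j : 'I_N, j < k})
    (weight (step_weight i k) (sqmon A) == 2 * d - i).
Proof.
move=> id; have -> : (weight (step_weight i k) (sqmon A) == 2 * d - i) =
    (L \subset A) && ([set j in A | k <= j] == set0).
  by rewrite -setD_eq0 -!cards_eq0; have := step_weightE; lia.
apply: (iffP andP) => [[/subsetP LA /eqP/setP k0]|[LA Ak]]; split.
- by move=> j ji; apply: LA; rewrite inE.
- by move=> j jA; have := k0 j; rewrite !inE jA ltnNge /= => ->.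
- by apply/subsetP=> j; rewrite inE; apply: LA.
- by apply/eqP/setP=> j; rewrite !inE; apply/negP => /andP[/Ak]; rewrite ltnNge => /negP.
Qed.

End StepWeight.
End SquarefreeSets.

Section LowerBound.
Variables (K : fieldType) (N : nat) (F : {set {set 'I_N}}) (b d n : nat).
Variable I : {pred {mpoly K[N]}}.
Hypothesis I_gen : I =i monomial_ideal (sqmons F).
Hypotheses (bd : b < d) (dn : d < n) (nN : n <= N).
Hypothesis F_card : {in F, forall A : {set 'I_N}, #|A| = d}.
Hypothesis F_del : forall i, b <= i <= d ->
  [set j : 'I_N | (j < d.+1) && (j != i :> nat)] \in F.
Hypothesis F_ins : forall k, d < k < n ->
  [set j : 'I_N | (j < d.-1) || (j == k :> nat)] \in F.

Lemma exists_fiber_chain :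
  exists2 P : 'I_(n - b).+1 -> {pred rees I}, prime_chain P
    & forall i, {subset @fiber_ideal K N I <= P i}.
Proof.
(* Step [t] of the chain is the face of the sets of [F] that contain the
   indices below [fi t] and none from [fk t] on; the last step, with [c = 0],
   is the empty face. *)
pose fi t := b + (t - (n - d.+1)); pose fk t := maxn (n - t) d.+1.
pose w t : 'I_N -> nat := step_weight (minn (fi t) d) (fk t).
pose c t := if t < n - b then 2 * d - fi t else 0.
pose g t := sqmon (if t < n - d.+1
  then [set j : 'I_N | (j < d.-1) || (j == (n - t).-1 :> nat)]
  else [set j : 'I_N | (j < d.+1) && (j != fi t :> nat)]).
have w0 t j : 0 < w t j by [].
have fid t : t < n - b -> minn (fi t) d = fi t by rewrite /fi; lia.
have fidle t : t < n - b -> fi t <= d by rewrite /fi; lia.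
have fiN t : t < n - b -> fi t <= N by rewrite /fi; lia.
have faceP t A : A \in F -> t < n - b -> reflect
    ((forall j : 'I_N, j < fi t -> j \in A) /\ {in A, forall j : 'I_N, j < fk t})
    (weight (w t) (sqmon A) == c t).
  move=> AF tn; rewrite /c tn /w fid //; apply: step_weight_minP; auto.
have cw t : t <= n - b -> {in sqmons F, forall h, c t <= weight (w t) h}.
  move=> _ _ /sqmonsP[A AF ->]; rewrite /c; case: ifP => // tn.
  by rewrite /w fid //; apply: step_weight_ge; auto.
have cw_last h : h \in sqmons F -> weight (w (n - b)) h <> c (n - b).
  case/sqmonsP=> A AF -> /eqP; rewrite /c ltnn weight_eq0 // -mdeg_eq0.
  by rewrite mdeg_sqmon F_card //; lia.
have gF t : t < n - b -> exists2 A, A \in F & g t = sqmon A.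
  rewrite /g => tn; eexists; last by [].
  case: ltnP => tnd; first by apply: F_ins; lia.
  by apply: F_del; rewrite /fi; lia.
exists (fun i : 'I_(n - b).+1 => weight_prime (I := I) (w i) (c i)); last first.
  move=> i; apply: (fiber_ideal_weight_prime I_gen) => //.
  by apply: cw; rewrite -ltnS.
apply: (weight_prime_chain I_gen (g := g)) => //.
- move=> s t /andP[st]; rewrite leq_eqVlt => /predU1P[->|tn] h.
    by move=> hG /(cw_last _ hG).
  case/sqmonsP=> A AF -> /eqP/(faceP _ _ AF tn)[Ai Ak]; apply/eqP/faceP => //.
    exact: ltn_trans tn.
  split=> j; first by move=> ji; apply: Ai; move: ji; rewrite /fi; lia.
  by move/Ak; rewrite /fk; lia.
- move=> t tn; have [A AF gA] := gF t tn; split; first by rewrite gA mem_sqmons.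
  move: gA; rewrite /g => gA; rewrite gA; apply/eqP/faceP => //.
  case: ltnP gA => tnd /sqmon_inj <-; split=> j; rewrite !inE /fi /fk; lia.
- move=> s t /andP[st tn]; have [A AF gA] := gF s (leq_trans st tn).
  move: tn; rewrite leq_eqVlt => /predU1P[->|tn].
    by apply: cw_last; rewrite gA mem_sqmons.
  rewrite gA => /eqP/(faceP _ _ AF tn)[Ai Ak]; move: gA Ai Ak; rewrite /g.
  case: ltnP => snd /sqmon_inj <- Ai Ak.
    have nN' : (n - s).-1 < N by lia.
    by have := Ak (Ordinal nN'); rewrite inE eqxx orbT /fk => /(_ isT) /=; lia.
  have fN : fi s < N by rewrite /fi; lia.
  by have := Ai (Ordinal fN); rewrite inE eqxx andbF /=; rewrite /fi; lia.
Qed.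

End LowerBound.

(** * An upper bound for the analytic spread *)

(** A matrix with more rows than columns has a nontrivial row relation. *)
Lemma linear_relation (K : fieldType) (A B : finType) (M : A -> B -> K) :
    #|B| < #|A| ->
  exists c : A -> K,
    (exists a, c a != 0%R) /\ forall b, (\sum_a c a * M a b = 0)%R.
Proof.
move=> BA; pose X := (\matrix_(i < #|A|, j < #|B|) M (enum_val i) (enum_val j))%R.
have /rowV0Pn[v /sub_kermxP vX v0] : kermx X != 0%R.
  by rewrite kermx_eq0 -row_leq_rank -ltnNge (leq_ltn_trans (rank_leq_col X)).
exists (fun a => v ord0 (enum_rank a)); split.
  have [j vj] := rV0Pn _ v0.
  by exists (enum_val j); rewrite enum_valK.
move=> b; have /rowP/(_ (enum_rank b)) := vX; rewrite !mxE => vX0.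
rewrite -[RHS]vX0 [RHS](reindex (@enum_rank A)) /=; last first.
  exact: onW_bij (enum_rank_bij _).
by apply: eq_bigr => a _; rewrite mxE !enum_rankK.
Qed.

Section UpperBound.
Local Open Scope ring_scope.
Variables (K : fieldType) (N : nat) (F : {set {set 'I_N}}) (d : nat).
Variables (L U : {set 'I_N}) (I : {pred {mpoly K[N]}}).
Hypothesis I_gen : I =i monomial_ideal (sqmons F).
Hypothesis F_card : {in F, forall A : {set 'I_N}, #|A| = d}.
Hypothesis F_ge : {in F, forall A : {set 'I_N}, L \subset A}.
Hypothesis F_le : {in F, forall A : {set 'I_N}, A \subset U}.
Hypothesis L_card : (#|L| < d)%N.

Lemma rees_const_subproof (a : K) : (a%:MP)%:P \in rees_pred I.
Proof.
apply/asboolP=> -[|r]; rewrite coefC //=.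
by case: (ideal_exp_is_ideal I r.+1).
Qed.

(** A scalar, as an element of degree 0 of the Rees algebra. *)
Definition rees_const a : rees I := Rees (rees_const_subproof a).

Lemma rees_const_unit a : a != 0 -> rees_const a^-1 * rees_const a = 1.
Proof.
move=> a0; apply: val_inj; rewrite rmorphM rmorph1 /= -polyCM -mpolyCM mulVf //.
Qed.

Lemma sqmons_mdeg : {in sqmons F, forall g, mdeg g = d}.
Proof. by move=> _ /sqmonsP[A AF ->]; rewrite mdeg_sqmon F_card. Qed.

(** A monomial of degree [d * r] in [I^r] is determined by its exponents on
    [U :\: L]: their sum determines [r], which is the exponent on [L], and the
    exponents off [U] vanish. *)
Lemma in_power_minimal r m : in_power (sqmons F) r m -> mdeg m = (d * r)%N ->
  [/\ forall i, (m i <= r)%N, {in L, forall i, m i = r},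
      forall i, i \notin U -> m i = 0%N
    & \sum_(i in U :\: L) m i = ((d - #|L|) * r)%N].
Proof.
case=> s [sr sG] sm mr.
have mE : m = (\big[+%MM/0%MM]_(g <- s) g).
  rewrite -[LHS](submK sm) (_ : (m - _)%MM = 0%MM) ?add0m //.
  apply/eqP; rewrite -mdeg_eq0; move: mr; rewrite -{1}(submK sm) mdegD mdeg_sum.
  rewrite (eq_big_seq (fun=> d)) => [|g /sG/sqmons_mdeg//].
  by rewrite big_const_seq count_predT iter_addn_0 sr -{2}[(d * r)%N]add0n => /addIn->.
have mEi i : m i = (\sum_(g <- s) g i)%N by rewrite mE mnm_sumE.
have mcst i k : {in sqmons F, forall g : 'X_{1..N}, g i = k} -> m i = (k * r)%N.
  move=> gk; rewrite mEi (eq_big_seq (fun=> k)) => [|g /sG/gk//].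
  by rewrite big_const_seq count_predT iter_addn_0 sr.
have mL : {in L, forall i, m i = r}.
  move=> i iL; rewrite (mcst i 1%N) ?mul1n // => _ /sqmonsP[A AF ->].
  by rewrite mnmE (subsetP (F_ge AF)).
have mU i : i \notin U -> m i = 0%N.
  move=> iU; rewrite (mcst i 0%N) ?mul0n // => _ /sqmonsP[A AF ->].
  by rewrite mnmE; apply/eqP; rewrite eqb0; apply: contra iU; apply/subsetP/F_le.
split=> //.
  move=> i; rewrite mEi -sr -sum1_size !big_seq; apply: leq_sum => _ /sG/sqmonsP[A _ ->].
  by rewrite mnmE leq_b1.
have [F0|[A AF]] := set_0Vmem F.
  have : r = 0%N.
    rewrite -sr; case: s sG {sr sm mE mEi mcst} => // g s /(_ g (mem_head _ _)).
    by case/sqmonsP=> A; rewrite F0 inE.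
  move=> r0; rewrite r0 !muln0 in mr *; rewrite big1 // => i _; apply/eqP.
  by move/eqP: mr; rewrite mdeg_eq0 => /eqP->; rewrite mnm0E.
have LU : L \subset U by apply: subset_trans (F_ge AF) (F_le AF).
have : mdeg m = (\sum_(i in U) m i)%N.
  rewrite mdegE (bigID (mem U)) /= [X in (_ + X)%N]big1 ?addn0 //.
rewrite mr (big_setID L) /= (setIidPr LU) (eq_bigr (fun=> r)) // sum_nat_const.
by rewrite mulnBl => ->; rewrite addKn.
Qed.

(** Let the [f k] witness the strictness of a chain of length [e]. The products
    of powers of the [f k] with exponents below [S] are more numerous than the
    restrictions to [U :\: L] of the monomials of degree [d * r] that occur in
    their coefficients of [t ^ r], so they satisfy a linear relation modulo the
    fiber ideal. *)
Lemma fiber_chain_le e (P : 'I_e.+1 -> {pred rees I}) : prime_chain P ->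
  {subset @fiber_ideal K N I <= P ord0} -> (e <= #|U :\: L|)%N.
Proof.
move=> Pchain JP; rewrite leqNgt; apply/negP; set q := #|_| => qe.
have [f fP] : {f : 'I_e -> rees I & forall k,
    f k \in P (lift ord0 k) /\ f k \notin P (widen_ord (leqnSn e) k)}.
  apply: (@boolp.choice _ _ (fun k x =>
    x \in P (lift ord0 k) /\ x \notin P (widen_ord (leqnSn e) k))) => k.
  have [|_ /existsNP[x /not_implyP[xP /negP xNP]]] :=
    proj2 Pchain (widen_ord (leqnSn e) k) (lift ord0 k); first by [].
  by exists x.
pose D := (\max_(i < e) size (val (f i)))%N.
(* The exponents of the relevant monomials are at most [R], and the choice of
   [S] makes [R.+1 ^ q < S ^ e]. *)
pose S := (((e * D).+1 ^ q).+1)%N; pose R := (e * (D * S))%N.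
pose T : finType := {i in U :\: L}.
pose rof (c : {ffun T -> 'I_R.+1}) : nat := ((\sum_t c t) %/ (d - #|L|))%N.
pose mof (c : {ffun T -> 'I_R.+1}) : 'X_{1..N} :=
  [multinom if i \in L then rof c else oapp (fun t => c t : nat) 0%N (insub i) | i < N].
pose fX (a : {ffun 'I_e -> 'I_S}) : rees I := \prod_(i < e) f i ^+ a i.
pose M (a : {ffun 'I_e -> 'I_S}) c : K := ((val (fX a))`_(rof c))@_(mof c).
have cardlt : (#|{: {ffun T -> 'I_R.+1}}| < #|{: {ffun 'I_e -> 'I_S}}|)%N.
  have -> : #|{: {ffun T -> 'I_R.+1}}| = (R.+1 ^ q)%N.
    by rewrite card_ffun card_ord card_sig.
  rewrite card_ffun !card_ord; apply: (@leq_ltn_trans (((e * D).+1 * S) ^ q)%N).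
    have : (R.+1 <= (e * D).+1 * S)%N by rewrite /R mulnA mulSn; lia.
    by case: (q) => // q'; rewrite leq_exp2r.
  rewrite expnMn; apply: (@leq_trans (S ^ q.+1)%N); last exact: leq_pexp2l.
  by rewrite expnS ltn_pmul2r ?expn_gt0.
have [c [[a0 ca0] cM]] := linear_relation M cardlt.
pose p := \sum_(a in [set a | c a != 0]) rees_const (c a) * fX a.
have : p \notin P ord0.
  apply: (prime_chain_free (f := f)) => //.
  - by move=> k; case: (fP k).
  - by move=> k; case: (fP k).
  - by apply/set0Pn; exists a0; rewrite inE.
  - by move=> a; rewrite inE => /rees_const_unit; exists (rees_const (c a)^-1).
case/negP; apply: JP; apply/asboolP=> r.
have /asboolP/(_ r) pI := valP p.
apply: (mem_irrelevant_exp I_gen sqmons_mdeg pI) => m mr.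
have pE r' m' : ((val p)`_r')@_m' = \sum_a c a * ((val (fX a))`_r')@_m'.
  rewrite rmorph_sum coef_sum raddf_sum /=.
  rewrite [RHS](bigID (fun a => c a == 0)) /= [in RHS]big1 ?add0r => [|a /eqP->]; last by rewrite mul0r.
  apply: eq_big => a; first by rewrite inE.
  by move=> _; rewrite coefCM mcoeffCM.
apply/eqP; rewrite mcoeff_eq0; apply/negP => mp.
have [mle mL mU mS] := in_power_minimal (ideal_exp_msupp I_gen pI mp) mr.
have rR : (r <= R)%N.
  have /existsP[a pa] : [exists a, ((val (fX a))`_r)@_m != 0].
    apply: contraLR mp; rewrite negb_exists mcoeff_msupp negbK pE => /forallP fX0.
    by rewrite big1 // => a _; have := fX0 a; rewrite negbK => /eqP->; rewrite mulr0.
  have : (r < size (val (fX a)))%N.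
    by apply: contraLR pa; rewrite -leqNgt => /(nth_default 0) ->; rewrite mcoeff0 eqxx.
  rewrite /fX rmorph_prod /= => /leq_trans/(_ (size_poly_prod_leq _ _)).
  suff : (\sum_(i < e) size (rees_val (f i ^+ a i)) <= R + e)%N.
    move: (\sum_(i < e) _)%N => x; rewrite card_ord; clearbody R; clear.
    by lia.
  apply: (@leq_trans (\sum_(i < e) (D * S).+1)%N); last first.
    by rewrite sum_nat_const card_ord /R mulnS addnC.
  apply: leq_sum => i _; rewrite -[rees_val _]/(val _) rmorphXn.
  apply: leq_trans (size_poly_exp_leq _ _) _; rewrite ltnS leq_mul //; last first.
    exact: ltnW.
  apply: leq_trans (leq_pred _) _.
  exact: (leq_bigmax (F := fun i : 'I_e => size (val (f i))) i).
pose cm : {ffun T -> 'I_R.+1} := [ffun t => inord (m (val t))].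
have cmE t : cm t = m (val t) :> nat.
  by rewrite ffunE inordK // ltnS (leq_trans (mle _)).
have rE : rof cm = r.
  rewrite /rof (eq_bigr (fun t => m (val t))) => [|t _]; last exact: cmE.
  by rewrite -(big_sub (U :\: L) (fun i => m i)) mS mulKn // subn_gt0.
have mE : mof cm = m.
  apply/mnmP => i; rewrite mnmE rE; case: ifP => [/mL|iL]; first by [].
  case: insubP => [t _ <-|]; first exact: cmE.
  by rewrite inE iL => /mU->.
by move: mp; rewrite mcoeff_msupp pE -[X in _ != X](cM cm) /M rE mE eqxx.
Qed.

End UpperBound.

(** * Squarefree Borel ideals *)

Section BorelSets.
Variable N : nat.
Implicit Types (A T : {set 'I_N}) (F : {set {set 'I_N}}) (v : 'X_{1..N}).

Lemma squarefree_sqmon A : squarefree (sqmon A).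
Proof. by apply/forallP=> i; rewrite mnmE leq_b1. Qed.

Lemma supp_sqmon A : supp (sqmon A) = A.
Proof. by apply/setP=> i; rewrite inE mnmE lt0b. Qed.

Lemma sqmon_supp v : squarefree v -> sqmon (supp v) = v.
Proof.
by move=> /forallP v1; apply/mnmP=> i; rewrite mnmE inE; case: (v i) (v1 i) => [|[]].
Qed.

Lemma lem_sqmon A v : (sqmon A <= v)%MM = (A \subset supp v).
Proof.
apply/mnm_lepP/subsetP => [Av i iA|Av i].
  by have := Av i; rewrite mnmE iA inE.
by rewrite mnmE; case: (boolP (i \in A)) => // /Av; rewrite inE.
Qed.

Lemma sqmon_swap A (i j : 'I_N) : j \in A -> i \notin A ->
  (U_(i) + (sqmon A - U_(j)))%MM = sqmon (i |: A :\ j).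
Proof.
move=> jA iA; apply/mnmP=> k; rewrite mnmDE mnmBE !mnm1E !mnmE !inE.
have [->|_] := eqVneq k i; first by rewrite (negPf iA).
rewrite /= add0n [j == k]eq_sym.
by have [->|_] := eqVneq k j; rewrite ?jA // subn0.
Qed.

Lemma card_swap A (i j : 'I_N) : j \in A -> i \notin A -> #|i |: A :\ j| = #|A|.
Proof.
move=> jA iA; rewrite cardsU1 !inE (negPf iA) andbF add1n.
by rewrite [in RHS](cardsD1 j) jA.
Qed.

(** Stability under the Borel moves: an element of a set may be replaced by a
    smaller one. *)
Definition swap_closed F := forall A (i j : 'I_N),
  A \in F -> j \in A -> i \notin A -> i < j -> (i |: A :\ j) \in F.

(** A set obtained from [A] by moving elements down lies in [F]; here the
    elements to be added are all smaller than the ones to be removed. *)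
Lemma exchange F A T : swap_closed F -> A \in F -> #|A| = #|T| ->
  (forall x y : 'I_N, x \in T :\: A -> y \in A :\: T -> x < y) -> T \in F.
Proof.
move=> Fswap; move: {2}#|T :\: A| (leqnn #|T :\: A|) => k.
elim: k A => [|k IHk] A; rewrite ?leqn0 => TA AF cardA ltTA.
  suff -> : T = A by [].
  by apply/eqP; rewrite eqEcard -setD_eq0 -cards_eq0 TA cardA leqnn.
have [/eqP TA0|/set0Pn[x xTA]] := eqVneq (T :\: A) set0.
  by rewrite (_ : T = A) //; apply/eqP; rewrite eqEcard -setD_eq0 TA0 cardA leqnn.
have /set0Pn[y yAT] : A :\: T != set0.
  rewrite -card_gt0; have := cardsID T A; have := cardsID A T; rewrite setIC cardA.
  have : 0 < #|T :\: A| by apply/card_gt0P; exists x.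
  lia.
have lt_xy := ltTA _ _ xTA yAT.
move: (xTA) (yAT); rewrite !inE => /andP[xA xT] /andP[yT yA].
apply: (IHk (x |: A :\ y)).
- rewrite -ltnS (leq_trans _ TA) // proper_card //; apply/properP; split.
    apply/subsetP=> z; rewrite !inE negb_or; case: (eqVneq z y) => [->|_].
      by rewrite (negPf yT) andbF.
    by case/andP=> /andP[_ ->] ->.
  by exists x; rewrite // !inE eqxx.
- exact: Fswap.
- by rewrite card_swap.
- move=> x' y'; rewrite !inE negb_or negb_and negbK => /andP[/andP[x'x x'yA] x'T].
  case/andP=> y'T /predU1P[y'x|/andP[y'y y'A]]; first by rewrite y'x xT in y'T.
  apply: ltTA; rewrite !inE ?y'T // x'T andbT; case/orP: x'yA => // /eqP x'y.
  by rewrite x'y (negPf yT) in x'T.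
Qed.

Lemma first_block_sub v : first_block v \subset supp v.
Proof.
rewrite /first_block; case: pickP => [i _|]; last by rewrite sub0set.
rewrite /pblock; case: pickP => [B /andP[]|]; last by rewrite sub0set.
by rewrite inE => /maxsetp/andP[].
Qed.

(** If the variable of index 0 divides [v], the first block of [v] is the
    longest initial segment of indices contained in its support. *)
Lemma mem_first_block v (z j : 'I_N) : z = 0 :> nat -> z \in supp v ->
  (j \in first_block v) = [forall i : 'I_N, (i <= j) ==> (i \in supp v)].
Proof.
move=> z0 zv; rewrite /first_block; case: pickP => [x /andP[xv /forallP xmin]|].
  have -> : x = z.
    by apply/ord_inj; have := xmin z; rewrite zv z0 leqn0 /= => /eqP.
  pose C := [set k : 'I_N | [forall i : 'I_N, (i <= k) ==> (i \in supp v)]].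
  have Cbl : block v C.
    apply/andP; split.
      by apply/subsetP=> k; rewrite inE => /forallP/(_ k); rewrite leqnn.
    apply/forall_inP=> i iC; apply/forall_inP=> k; rewrite inE => /forallP kC.
    apply/forallP=> l; apply/implyP=> /andP[_ lk]; rewrite inE.
    by apply/forallP=> i'; apply/implyP=> i'l; have := kC i'; rewrite (leq_trans i'l).
  have zC : z \in C.
    rewrite inE; apply/forallP=> i; apply/implyP; rewrite z0 leqn0 => /eqP i0.
    by rewrite (_ : i = z) //; apply: ord_inj; rewrite i0.
  (* A maximal block through the first variable is the initial segment [C]. *)
  have CE B : maxset (block v) B -> z \in B -> B = C.
    case/maxsetP=> /andP[Bv Bcons] Bmax zB; apply: esym; apply: Bmax => //.
    apply/subsetP=> k kB; rewrite inE; apply/forallP=> i; apply/implyP=> ik.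
    apply: (subsetP Bv); have /forall_inP/(_ z zB)/forall_inP/(_ k kB) := Bcons.
    by move=> /forallP/(_ i)/implyP; apply; rewrite z0 ik.
  rewrite /pblock; case: pickP => [B /andP[]|noB] /=.
    by rewrite inE => Bmax /(CE _ Bmax)->; rewrite inE.
  have [B Bmax CB] := maxset_exists Cbl.
  have BD : B \in block_decomposition v by rewrite inE.
  by have := noB B; rewrite /= BD (subsetP CB).
move=> /(_ z); rewrite zv /= => /negP[]; apply/forallP=> i; apply/implyP=> _.
by rewrite z0.
Qed.

End BorelSets.

Section BorelIdeals.
Variables (K : fieldType) (N : nat).

Lemma squarefree_borel_monomial_ideal (F : {set {set 'I_N}}) : swap_closed F ->
  squarefree_borel (monomial_ideal (K := K) (sqmons F)).
Proof.
move=> Fswap; split.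
  by exists (sqmons F) => // _ /sqmonsP[A _ ->]; apply: squarefree_sqmon.
move=> v i j vsf; rewrite mem_monomial_ideal => /asboolP[_ /sqmonsP[A AF ->]].
rewrite lem_sqmon => Av jv ij /= /forallP/(_ i).
rewrite mnmDE mnmBE !mnm1E eqxx (_ : (j == i) = false); last first.
  by apply/negP=> /eqP ji; rewrite ji ltnn in ij.
rewrite subn0 -[X in _ <= X]addn0 leq_add2l leqn0 => /eqP vi.
have iv : i \notin supp v by rewrite inE vi.
rewrite -(sqmon_supp vsf) sqmon_swap // mem_monomial_ideal; apply/asboolP.
have [jA|jA] := boolP (j \in A); last first.
  exists (sqmon A); rewrite ?mem_sqmons // lem_sqmon supp_sqmon.
  apply/subsetP=> k kA; rewrite in_setU1 in_setD1 (memPn jA) //.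
  by rewrite (subsetP Av) // orbT.
have iA : i \notin A by apply: contra iv; apply/subsetP.
exists (sqmon (i |: A :\ j)); first by apply/mem_sqmons/Fswap.
by rewrite lem_sqmon supp_sqmon setUS // setSD.
Qed.

Section BorelGenerated.
Variables (m d : nat) (u : 'I_m -> 'X_{1..N}) (I : {pred {mpoly K[N]}}).
Hypothesis u_squarefree : forall k, squarefree (u k).
Hypothesis u_deg : forall k, mdeg (u k) = d.
Hypothesis I_gen : borel_generated u I.

Lemma borel_generated_swap (F : {set {set 'I_N}}) : swap_closed F ->
    (forall k, supp (u k) \in F) -> {in F, forall A, 'X_[sqmon A] \in I} ->
  I =i monomial_ideal (sqmons F).
Proof.
move=> Fswap uF FI p; have [[[S _ IS] _] _ Imin] := I_gen.
apply/idP/idP; last first.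
  apply: gen_ideal_min p; last first.
    by move=> _ /asboolP[_ /sqmonsP[A AF ->] ->]; apply: FI.
  have [S0 SD] := gen_ideal_is_ideal [pred p : {mpoly K[N]}
    | `[< exists2 u, u \in S & p = 'X_[u] >]].
  split=> [|a x y]; rewrite !IS //; exact: SD.
apply: Imin p; first exact: squarefree_borel_monomial_ideal.
move=> k; rewrite -(sqmon_supp (u_squarefree k)) mem_monomial_ideal.
by apply/asboolP; exists (sqmon (supp (u k))); rewrite ?mem_sqmons ?lepm_refl.
Qed.

(** The supports of the squarefree monomials of degree [d] in [I]. *)
Definition borel_sets : {set {set 'I_N}} :=
  [set A : {set 'I_N} | (#|A| == d) && ('X_[sqmon A] \in I)].

Lemma card_supp k : #|supp (u k)| = d.
Proof. by rewrite -mdeg_sqmon sqmon_supp. Qed.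

Lemma supp_borel_sets k : supp (u k) \in borel_sets.
Proof. by have [_ uI _] := I_gen; rewrite inE card_supp eqxx sqmon_supp /=. Qed.

Lemma borel_sets_swap : swap_closed borel_sets.
Proof.
move=> A i j; rewrite !inE => /andP[/eqP Ad AI] jA iA ij.
have [[_ borel] _ _] := I_gen; rewrite card_swap // Ad eqxx -sqmon_swap //.
apply: borel => //; first exact: squarefree_sqmon.
  by rewrite supp_sqmon.
by rewrite sqmon_swap //; apply: squarefree_sqmon.
Qed.

Lemma borel_sets_gen : I =i monomial_ideal (sqmons borel_sets).
Proof.
apply: borel_generated_swap; [exact: borel_sets_swap|exact: supp_borel_sets|].
by move=> A; rewrite inE => /andP[].
Qed.

(** By minimality, [borel_sets] is the smallest family of sets with [d]
    elements that is stable under swaps and contains the supports of the Borel generators. *)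
Lemma borel_sets_min (F : {set {set 'I_N}}) : swap_closed F ->
    {in F, forall A : {set 'I_N}, #|A| = d} -> (forall k, supp (u k) \in F) ->
  {subset borel_sets <= F}.
Proof.
move=> Fswap Fd uF A; rewrite inE => /andP[/eqP Ad AI].
have [_ _ /(_ _ (squarefree_borel_monomial_ideal Fswap))] := I_gen.
have uJ k : 'X_[u k] \in monomial_ideal (K := K) (sqmons F).
  rewrite -(sqmon_supp (u_squarefree k)) mem_monomial_ideal.
  by apply/asboolP; exists (sqmon (supp (u k))); rewrite ?mem_sqmons ?lepm_refl.
move=> /(_ uJ _ AI); rewrite mem_monomial_ideal => /asboolP[_ /sqmonsP[B BF ->]].
rewrite lem_sqmon supp_sqmon => BA; suff <- : B = A by [].
by apply/eqP; rewrite eqEcard BA Ad Fd //=.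
Qed.

(** Otherwise either there is no Borel generator and [I] is zero, or they are
    all equal to the product of the first [d] variables, which generates [I]. *)
Lemma nonprincipal_supp : ~ principal I ->
  exists k (j : 'I_N), j < d /\ j \notin supp (u k).
Proof.
move=> Inp; apply: contrapT => ex; apply: Inp.
have suppE k : supp (u k) = [set j : 'I_N | j < d].
  apply/esym/eqP; rewrite eqEcard card_supp card_ord_lt ?leqnn ?andbT; last first.
    by rewrite -(card_supp k) -[X in _ <= X]card_ord max_card.
  apply/subsetP=> j; rewrite inE => jd; apply: contrapT => /negP jk.
  by apply: ex; exists k, j.
pose F := [set supp (u k) | k : 'I_m].
have IF : I =i monomial_ideal (sqmons F).
  apply: borel_generated_swap.
  - move=> A i j /imsetP[k _ ->]; rewrite suppE !inE -leqNgt => jd di ij.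
    by have := leq_ltn_trans di (ltn_trans ij jd); rewrite ltnn.
  - by move=> k; apply: imset_f.
  - move=> _ /imsetP[k _ ->]; rewrite sqmon_supp //.
    by case: I_gen => _ uI _; apply: uI.
have [F0|[A AF]] := set_0Vmem F.
  exists 0%R => p; rewrite IF; apply/idP/idP; move: p; apply: gen_ideal_min;
    try exact: gen_ideal_is_ideal.
    by move=> q /asboolP[g /sqmonsP[A]]; rewrite F0 inE.
  by move=> _ /eqP->; case: (gen_ideal_is_ideal (R := {mpoly K[N]})
    [pred p | `[< exists2 u, u \in sqmons F & p = 'X_[u] >]]).
exists 'X_[sqmon A] => p; rewrite IF; apply/idP/idP; move: p; apply: gen_ideal_min;
    try exact: gen_ideal_is_ideal.
  move=> _ /asboolP[_ /sqmonsP[A' A'F ->] ->]; apply: mem_gen_ideal.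
  case/imsetP: A'F => k _ ->; case/imsetP: AF => k' _ ->.
  by rewrite !suppE inE eqxx.
move=> _ /eqP->; apply/mem_gen_ideal/asboolP.
by exists (sqmon A) => //; apply: mem_sqmons.
Qed.

End BorelGenerated.
End BorelIdeals.

(** * The analytic spread of a squarefree Borel ideal *)

Section BorelSpread.
Variables (K : fieldType) (N m d : nat) (u : 'I_m -> 'X_{1..N}).
Variable I : {pred {mpoly K[N]}}.
Hypothesis u_squarefree : forall i, squarefree (u i).
Hypothesis u_deg : forall i, mdeg (u i) = d.
Hypothesis I_gen : borel_generated u I.
Local Notation n := (\max_(i < m) max_supp (u i)).

Lemma supp_lt_max k (i : 'I_N) : i \in supp (u k) -> i < n.
Proof.
move=> ik; apply: leq_trans (leq_bigmax (F := fun k => max_supp (u k)) k).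
exact: (leq_bigmax_cond (F := fun i : 'I_N => i.+1)).
Qed.

Lemma max_supp_ord : n <= N.
Proof. by apply/bigmax_leqP=> k _; apply/bigmax_leqP=> i _; apply: ltn_ord. Qed.

Lemma supp_max_attained : 0 < m -> 0 < d ->
  exists k (i : 'I_N), i \in supp (u k) /\ i.+1 = n.
Proof.
move=> m0 d0; have m_gt0 : 0 < #|'I_m| by rewrite card_ord.
have [k ->] := eq_bigmax (fun k => max_supp (u k)) m_gt0.
have ne : 0 < #|supp (u k)| by rewrite (card_supp u_squarefree u_deg).
by have [i ik iE] := eq_bigmax_cond (fun i : 'I_N => i.+1) ne; exists k, i.
Qed.

(** [b] is the largest integer such that the first [b] variables divide all
    the Borel generators. *)
Lemma borel_has_analytic_spread b (k0 : 'I_m) (i0 : 'I_N) :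
    b < d -> i0 = b :> nat -> i0 \notin supp (u k0) ->
    (forall k (i : 'I_N), i < b -> i \in supp (u k)) ->
  has_analytic_spread I (n - b).
Proof.
move=> bd i0b i0k bsub.
have cardS := card_supp u_squarefree u_deg.
have dN : d <= N by rewrite -(cardS k0) -[X in _ <= X]card_ord max_card.
have nN := max_supp_ord.
have dn : d < n.
  rewrite ltnNge; apply/negP => nd.
  suff : #|supp (u k0)| < d by rewrite cardS ltnn.
  rewrite -(card_ord_lt dN); apply: proper_card; apply/properP; split.
    by apply/subsetP=> i /supp_lt_max; rewrite inE => /leq_trans; apply.
  by exists i0; rewrite // inE i0b.
pose F := borel_sets d I.
have Fswap : swap_closed F by apply: borel_sets_swap I_gen.
have uF k : supp (u k) \in F by apply: supp_borel_sets I_gen k.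
have IF : I =i monomial_ideal (sqmons F) by apply: borel_sets_gen I_gen.
have F_card : {in F, forall A : {set 'I_N}, #|A| = d}.
  by move=> A; rewrite inE => /andP[/eqP].
pose L := [set i : 'I_N | i < b]; pose U := [set i : 'I_N | i < n].
have FLU : {in F, forall A : {set 'I_N}, L \subset A /\ A \subset U}.
  pose G := [set A : {set 'I_N} | [&& #|A| == d, L \subset A & A \subset U]].
  suff : {subset F <= G} by move=> FG A /FG; rewrite inE => /and3P[].
  apply: (borel_sets_min u_squarefree I_gen) => //.
  - move=> A i j; rewrite !inE => /and3P[/eqP Ad LA AU] jA iA ij.
    rewrite card_swap // Ad eqxx /=; apply/andP; split; apply/subsetP=> x.
      rewrite inE => xb; rewrite in_setU1 in_setD1 (subsetP LA) ?inE // andbT.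
      apply/orP; right; apply: contra iA => /eqP xj; apply: (subsetP LA).
      by rewrite inE (ltn_trans ij) // -xj.
    rewrite in_setU1 in_setD1 => /predU1P[->|/andP[_ xA]]; last exact: (subsetP AU).
    by have := subsetP AU _ jA; rewrite !inE; apply: ltn_trans.
  - by move=> A; rewrite inE => /and3P[/eqP].
  - move=> k; rewrite inE cardS eqxx /=; apply/andP; split; apply/subsetP=> i.
      by rewrite inE; apply: bsub.
    by move/supp_lt_max; rewrite inE.
have m0 : 0 < m := leq_ltn_trans (leq0n _) (ltn_ord k0).
apply: (has_krull_dim_quot (J := @fiber_ideal K N I)).
  apply: (exists_fiber_chain IF bd dn nN) => //.
  - move=> i /andP[bi id].
    have iN : i < N by apply: leq_ltn_trans id (leq_trans dn nN).
    pose oi := Ordinal iN.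
    (* Make room at [i] by moving it, if needed, to the free position [b]. *)
    have [A AF iA] : exists2 A, A \in F & oi \notin A.
      have [iA|iA] := boolP (oi \in supp (u k0)); last by exists (supp (u k0)).
      have i0i : i0 != oi by apply: contraNneq i0k => ->.
      exists (i0 |: supp (u k0) :\ oi).
        apply: Fswap => //; rewrite ltn_neqAle i0i /=.
        by rewrite i0b.
      by rewrite !inE negb_or eq_sym i0i eqxx.
    apply: (exchange Fswap AF).
      rewrite F_card //; have := cardsD1 oi [set j : 'I_N | j < d.+1].
      rewrite card_ord_lt ?inE /=; last by lia.
      rewrite ltnS id add1n => -[dE]; rewrite [LHS]dE.
      by apply: eq_card => j; rewrite !inE andbC.
    move=> x y; rewrite !inE => /andP[_ /andP[xd _]] /andP[yT yA].
    have yi : y != i :> nat.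
      by apply: contraNneq iA => yi; rewrite (_ : oi = y) //; apply: val_inj.
    by move: yT; rewrite yi andbT -leqNgt; apply: leq_trans.
  - move=> k /andP[dk kn].
    have kN : k < N by apply: leq_trans nN.
    pose ok := Ordinal kN.
    have [k1 [i1 [i1k i1n]]] := supp_max_attained m0 (leq_ltn_trans (leq0n _) bd).
    have [A AF kA] : exists2 A, A \in F & ok \in A.
      have [kA|kA] := boolP (ok \in supp (u k1)); first by exists (supp (u k1)).
      exists (ok |: supp (u k1) :\ i1); last by rewrite !inE eqxx.
      apply: Fswap => //; rewrite ltn_neqAle -ltnS i1n kn andbT.
      by apply: contraNneq kA => e; rewrite (_ : ok = i1) //; apply: val_inj.
    apply: (exchange Fswap AF).
      rewrite F_card // (_ : [set j | _] = ok |: [set j : 'I_N | j < d.-1]).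
        by rewrite cardsU1 card_ord_lt ?inE /=; lia.
      by apply/setP=> j; rewrite !inE orbC -val_eqE.
    move=> x y; rewrite !inE negb_or -leqNgt => /andP[xA /orP[xd|xk]].
      by case/andP=> /andP[yd _] _; apply: leq_trans yd.
    by case/negP: xA; rewrite (_ : x = ok) //; apply/val_inj/eqP.
move=> e P Pchain JP.
have -> : n - b = #|U :\: L|.
  rewrite cardsD (setIidPr _) ?card_ord_lt //; last first.
    by apply/subsetP=> i; rewrite !inE => /ltn_trans; apply; apply: ltn_trans dn.
  by rewrite ltnW // (leq_trans bd dN).
apply: (fiber_chain_le IF F_card _ _ _ Pchain JP).
- by move=> A /FLU[].
- by move=> A /FLU[].
- rewrite card_ord_lt //; exact: leq_trans (ltnW bd) dN.
Qed.

End BorelSpread.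

Theorem theorem3p3 (K : fieldType) (N m d : nat) (u : 'I_m -> 'X_{1..N})
    (I : {pred {mpoly K[N]}})
    (u_squarefree : forall i, squarefree (u i))
    (u_deg : forall i, mdeg (u i) = d)
    (I_gen : borel_generated u I)
    (I_nonprincipal : ~ principal I) :
  let n := \max_(i < m) max_supp (u i) in
  let B := \bigcap_(i < m) first_block (u i) in
  has_analytic_spread I
    (if [exists i in B, nat_of_ord i == 0] then n - #|B| else n).
Proof.
move=> n B.
have [k [j [jd jk]]] := nonprincipal_supp u_squarefree u_deg I_gen I_nonprincipal.
pose P b := [exists k, exists i : 'I_N, (i == b :> nat) && (i \notin supp (u k))].
have exP : exists b, P b.
  by exists j; apply/existsP; exists k; apply/existsP; exists j; rewrite eqxx.
have [b /existsP[k0 /existsP[i0 /andP[/eqP i0b i0k]]] bmin] := ex_minnP exP.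
have bsub k' (i : 'I_N) : i < b -> i \in supp (u k').
  rewrite ltnNge; apply: contraNT => ik; apply: bmin.
  by apply/existsP; exists k'; apply/existsP; exists i; rewrite eqxx.
have bd : b < d.
  apply: leq_ltn_trans jd; apply: bmin.
  by apply/existsP; exists k; apply/existsP; exists j; rewrite eqxx.
rewrite (_ : (if _ then _ else _) = n - b).
  exact: (borel_has_analytic_spread u_squarefree u_deg I_gen bd i0b i0k bsub).
have [b0|b_gt0] := posnP b.
  rewrite b0 subn0 ifN //; apply/negP => /exists_inP[i iB /eqP iz].
  case/negP: i0k; rewrite (_ : i0 = i); last by apply: ord_inj; rewrite iz i0b.
  by apply: (subsetP (first_block_sub _)); move/bigcapP: iB; apply.
have N0 : 0 < N := leq_ltn_trans (leq0n _) (ltn_ord i0).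
pose z := Ordinal N0; have zu k' : z \in supp (u k') by apply: bsub.
have BE : B = [set i : 'I_N | i < b].
  apply/setP=> i; rewrite inE; apply/bigcapP/idP => [iB|ib k' _].
    rewrite ltnNge; apply: contra i0k => bi.
    have := iB k0 isT; rewrite (mem_first_block (z := z)) ?zu //.
    by move/forallP/(_ i0)/implyP; apply; rewrite i0b.
  rewrite (mem_first_block (z := z)) ?zu //.
  by apply/forallP=> i'; apply/implyP=> i'i; rewrite bsub // (leq_ltn_trans i'i).
have bN : b <= N by rewrite -i0b ltnW.
rewrite ifT BE ?card_ord_lt //.
by apply/exists_inP; exists z; rewrite ?inE.
Qed.
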